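(* For every $\delta>0$ there exists a constant $C$ such that the following holds: for every $\eta>0$ there is $n_0$ such that for all $n\ge n_0$ and all integers $m$ with $Cn^2\le m\le\binom n3$, the number of triangle-free $3$-uniform hypergraphs on vertex set $[n]$ with exactly $m$ edges that cannot be made tripartite by removing at most $\delta m$ edges is at most $\eta$ times the number of all triangle-free $3$-uniform hypergraphs on $[n]$ with exactly $m$ edges. (That is, almost every triangle-free $3$-uniform hypergraph with $n$ vertices and $m$ edges can be made tripartite by removing at most $\delta m$ edges.)
   Context: $F_5$ denotes the $3$-uniform hypergraph with edge set $\{123,124,345\}$; a $3$-uniform hypergraph is triangle-free if it contains no (not necessarily induced) copy of $F_5$. A $3$-uniform hypergraph is tripartite if its vertex set can be partitioned into three parts so that every edge has exactly one vertex in each part. *)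

(* Defs.v *)
From mathcomp Require Import all_boot all_order all_algebra.
From mathcomp Require Import reals.

Set Implicit Arguments.
Unset Strict Implicit.
Unset Printing Implicit Defensive.

Import Order.TTheory GRing.Theory Num.Theory.

(* A hypergraph on the vertex set T is its edge set. *)
Definition hypergraph (T : finType) := {set {set T}}.

Definition uniform (T : finType) (k : nat) (H : hypergraph T) : bool :=
  [forall e in H, #|e| == k].

(* A copy is an injection of the vertices mapping edges to edges; it need not
   be induced. *)
Definition has_copy (U T : finType) (F : hypergraph U) (H : hypergraph T)
  : bool :=
  [exists f : {ffun U -> T},
     injectiveb f && [forall e in F, f @: e \in H]].

(* Edges 123, 124, 345, with the vertices 1, ..., 5 renumbered 0, ..., 4. *)
Definition F5 : hypergraph 'I_5 :=
  [set [set inord 0; inord 1; inord 2];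
       [set inord 0; inord 1; inord 3];
       [set inord 2; inord 3; inord 4]].

Definition triangle_free (T : finType) (H : hypergraph T) : bool :=
  ~~ has_copy F5 H.

(* The three parts are the fibres of c; a part may be empty. *)
Definition tripartite (T : finType) (H : hypergraph T) : bool :=
  [exists c : {ffun T -> 'I_3},
     [forall e in H, [forall i : 'I_3, #|[set x in e | c x == i]| == 1]]].

Definition tripartite_after_removing (R : realType) (T : finType) (r : R)
    (H : hypergraph T) : bool :=
  [exists D : hypergraph T,
     [&& D \subset H, (#|D|%:R <= r)%R & tripartite (H :\: D)]].

Definition triangle_free_hypergraphs (n m : nat) : {set hypergraph 'I_n} :=
  [set H : hypergraph 'I_n | [&& uniform 3 H, triangle_free H & #|H| == m]].

(* Main.v *)
Require Import Defs.
From mathcomp Require Import all_boot all_order all_algebra.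
From mathcomp Require Import reals sequences exp.
From mathcomp Require Import ring lra zify.

(* For a triangle-free H let Q be the graph of the pairs of codegree at least 3.
   Each neighbourhood N(xy) is independent in Q, so the elementary container
   lemma for dense graphs captures N(xy) up to O(1) of its vertices.  Together
   with the edges containing a pair outside Q (at most two per pair) this gives a
   fingerprint S of H with O(n^2) edges such that Q and S determine a container G
   of H \ S, all pairs of edges of G lying in Q, and every N_G(xy) spanning few
   edges of Q.

   Let d be the codegree in G and D the degree in Q.  For an edge xyz the sets
   N_G(yz) and N_Q(x) are almost disjoint, so d(yz) + D(x) is at most about n.
   The sum of 1 / (d(xy) D(x)) over ordered edges is at most n, and AM-GM turns
   this into an upper bound on |G|; if |G| is close to n^3 / 27, some edge xyz has
   N(xy), N(yz), N(xz) almost partitioning the vertices, and the sparsity of Q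
   inside these sets makes the partition an almost tripartition of G.

   Hence every container is either smaller than n^3 / 27 by a constant factor, or
   almost tripartite; in the latter case a far H has unusually many edges in the
   small exceptional part of G.  Both events are exponentially rare in m compared
   with the subsets of size m of a largest tripartite hypergraph. *)

Set Implicit Arguments.
Unset Strict Implicit.
Unset Printing Implicit Defensive.

Import Order.TTheory GRing.Theory Num.Theory.
Local Open Scope ring_scope.

(** * Stability *)

Section TripleSums.
Variables (R : realFieldType) (V : finType) (a : V -> V -> V -> bool).
Hypothesis a12 : forall x y z, a x y z = a y x z.
Hypothesis a23 : forall x y z, a x y z = a x z y.
Implicit Types F G : V -> V -> V -> R.

Definition edge_sum F : R := \sum_x \sum_y \sum_z (a x y z)%:R * F x y z.

Lemma edge_sumD F G :
  edge_sum (fun x y z => F x y z + G x y z) = edge_sum F + edge_sum G.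
Proof.
rewrite /edge_sum -big_split; apply: eq_bigr => x _.
rewrite -big_split; apply: eq_bigr => y _.
by rewrite -big_split; apply: eq_bigr => z _; rewrite mulrDr.
Qed.

Lemma edge_sumZ k F :
  edge_sum (fun x y z => k * F x y z) = k * edge_sum F.
Proof.
rewrite /edge_sum mulr_sumr; apply: eq_bigr => x _.
rewrite mulr_sumr; apply: eq_bigr => y _.
by rewrite mulr_sumr; apply: eq_bigr => z _; rewrite mulrCA.
Qed.

Lemma ler_edge_sum F G :
  (forall x y z, a x y z -> F x y z <= G x y z) -> edge_sum F <= edge_sum G.
Proof.
move=> le_FG; do 3![apply: ler_sum => ? _].
by case Ha: (a _ _ _); rewrite ?mul0r ?mul1r ?le_FG.
Qed.

Lemma edge_sum_swap12 F : edge_sum (fun x y z => F y x z) = edge_sum F.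
Proof.
rewrite /edge_sum exchange_big; apply: eq_bigr => x _; apply: eq_bigr => y _.
by apply: eq_bigr => z _; rewrite a12.
Qed.

Lemma edge_sum_swap23 F : edge_sum (fun x y z => F x z y) = edge_sum F.
Proof.
apply: eq_bigr => x _; rewrite exchange_big; apply: eq_bigr => y _.
by apply: eq_bigr => z _; rewrite a23.
Qed.

Lemma edge_sum1 :
  edge_sum (fun=> fun=> fun=> 1)
  = #|[set t : V * V * V | a t.1.1 t.1.2 t.2]|%:R.
Proof.
rewrite -sum1_card natr_sum /edge_sum pair_bigA pair_bigA [RHS]big_mkcond /=.
by apply: eq_bigr => t _; rewrite inE mulr1; case: (a _ _ _).
Qed.

End TripleSums.

(** AM-GM for [u], [v] and [3 - u - v], whose mean is 1; a nonpositive third factor is harmless. *)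
Lemma mul2_3sub_le1 (R : realFieldType) (u v : R) :
  0 < u -> 0 < v -> u * v * (3 - u - v) <= 1.
Proof.
move=> u0 v0; case: (lerP (3 - u - v) 0) => [h|h].
  by apply: le_trans ler01; rewrite pmulr_rle0 // mulr_gt0.
have -> : 1 = (u + v) ^+ 2 * (3 - u - v) / 4
            + (u + v + 1) * (u + v - 2) ^+ 2 / 4 by field.
have h1 : 0 <= (u - v) ^+ 2 * (3 - u - v) by rewrite mulr_ge0 ?sqr_ge0 // ltW.
have h2 : 0 <= (u + v + 1) * (u + v - 2) ^+ 2.
  by rewrite mulr_ge0 ?sqr_ge0 //; lra.
by rewrite -subr_ge0; move: h1 h2; rewrite !expr2 => h1 h2; lra.
Qed.

Lemma card_setU3_ge (R : realFieldType) (V : finType) (A B C : {set V}) :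
  #|A|%:R + #|B|%:R + #|C|%:R
    - #|A :&: B|%:R - #|B :&: C|%:R - #|C :&: A|%:R
  <= #|A :|: B :|: C|%:R :> R.
Proof.
have := cardsUI (A :|: B) C; have := cardsUI A B.
have : (#|(A :|: B) :&: C| <= #|B :&: C| + #|C :&: A|)%N.
  by rewrite setIUl setUC [A :&: C]setIC; apply: leq_card_setU.
move=> h1 h2 h3.
have : (#|A| + #|B| + #|C| <= #|A :|: B :|: C| + #|A :&: B| + #|B :&: C| + #|C :&:
  A|)%N.
  by lia.
rewrite -(ler_nat R) !natrD; lra.
Qed.

Section Stability.
Variables (R : realFieldType) (V : finType) (a : V -> V -> V -> bool).
Variable Q : rel V.
Hypothesis a12 : forall x y z, a x y z = a y x z.
Hypothesis a23 : forall x y z, a x y z = a x z y.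
Hypothesis aQ : forall x y z, a x y z -> Q x y.

(* [a] is the edge relation; the graph [Q] contains its shadow, and plays the role
   of the shadow itself. *)
Definition nbrs x y := [set z | a x y z].
Definition Qnbrs x := [set y | Q x y].
Local Notation n := (#|V|%:R : R).
Local Notation d x y := (#|nbrs x y|%:R : R).
Local Notation D x := (#|Qnbrs x|%:R : R).
Local Notation w x y z := (#|nbrs y z :&: Qnbrs x|%:R : R).

(** Summing over [z] cancels [d x y], and summing over [y] in [Qnbrs x] then cancels [D x], so each
    [x] contributes at most 1. *)
Lemma edge_sum_inv_deg : edge_sum a (fun x y z => (d x y * D x)^-1) <= n.
Proof.
rewrite -sum1_card natr_sum; apply: ler_sum => x _.
have h y : \sum_z (a x y z)%:R * (d x y * D x)^-1 <= (Q x y)%:R / D x.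
  rewrite -mulr_suml invfM mulrA.
  have -> : \sum_z ((a x y z)%:R : R) = d x y.
    rewrite -sum1_card natr_sum [RHS]big_mkcond /=; apply: eq_bigr => z _.
    by rewrite inE; case: (a x y z).
  apply: ler_wpM2r; first by rewrite invr_ge0 ler0n.
  have [->|dn0] := eqVneq (d x y) 0; first by rewrite mul0r ler0n.
  rewrite mulfV //; move: dn0; rewrite pnatr_eq0 cards_eq0.
  by case/set0Pn=> z; rewrite inE => /aQ ->.
apply: le_trans (ler_sum _ (fun y _ => h y)) _; rewrite -mulr_suml.
have -> : \sum_y ((Q x y)%:R : R) = D x.
  rewrite -sum1_card natr_sum [RHS]big_mkcond /=; apply: eq_bigr => y _.
  by rewrite inE; case: (Q x y).
by have [->|dn0] := eqVneq (D x) 0; rewrite ?mul0r // mulfV.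
Qed.

(** AM-GM at [u = 3 d / n] and [v = 3 D / (2 n)]; both are 1 in the balanced complete tripartite
    hypergraph, where the bound is tight. *)
Lemma inv_deg_ge x y z : a x y z ->
  3 * n - 3 * d x y - 3 / 2 * D x <= 2 / 9 * n ^+ 3 * (d x y * D x)^-1.
Proof.
move=> ha.
have n0 : 0 < n by rewrite ltr0n; apply/card_gt0P; exists x.
have d0 : 0 < d x y by rewrite ltr0n; apply/card_gt0P; exists z; rewrite inE.
have D0 : 0 < D x.
  by rewrite ltr0n; apply/card_gt0P; exists y; rewrite inE (aQ ha).
rewrite ler_pdivlMr ?mulr_gt0 //.
have n1 : n != 0 by rewrite gt_eqF.
have h : (3 * d x y / n) * (3 / 2 * D x / n) * (3 - 3 * d x y / n - 3 / 2 * D x / n) <=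
  1.
  by apply: mul2_3sub_le1; rewrite divr_gt0 ?mulr_gt0 ?invr_gt0 // ltr0n.
have e0 : 0 <= 2 / 9 * n ^+ 3 by rewrite mulr_ge0 ?exprn_ge0 ?ler0n // divr_ge0 ?ler0n.
have := ler_wpM2l e0 h; rewrite mulr1; apply: le_trans.
by rewrite le_eqVlt; apply/orP; left; apply/eqP; field.
Qed.

Lemma deg_sum_le x y z : D x <= n - d y z + w x y z.
Proof.
rewrite addrAC lerBrDr -natrD -natrD ler_nat addnC.
by rewrite -cardsUI leq_add2r max_card.
Qed.

Variable b : R.
Hypothesis b0 : 0 < b.
Hypothesis b9 : b <= 1 / 9.
Hypothesis sparse : forall y z, \sum_(t in nbrs y z) w t y z <= b * n ^+ 2.
Hypothesis dense : (2 / 9 - b) * n ^+ 3 <= edge_sum a (fun=> fun=> fun=> 1).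
Hypothesis n0 : 0 < n.

(* For an edge [xyz] the sets [nbrs y z] and [Qnbrs x] are almost disjoint. *)
Lemma exists_balanced_edge : exists x y z, a x y z /\
  n - d x y - d y z - d x z + w x y z + w y x z + w z x y <= 81 * b * n.
Proof.
have denseM := dense; set M := edge_sum a _ in denseM.
pose Del := edge_sum a (fun x y z => d x y).
pose W := edge_sum a (fun x y z => w x y z).
have eDel3 : edge_sum a (fun x y z => d x z) = Del.
  by rewrite (edge_sum_swap23 a23 (fun x y z => d x y)).
have eDel2 : edge_sum a (fun x y z => d y z) = Del.
  by rewrite (edge_sum_swap12 a12 (fun x y z => d x z)).
have eW2 : edge_sum a (fun x y z => w y x z) = W.
  by rewrite (edge_sum_swap12 a12 (fun x y z => w x y z)).
have eW3 : edge_sum a (fun x y z => w z x y) = W.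
  rewrite (edge_sum_swap23 a23 (fun x y z => w y x z)).
  by rewrite (edge_sum_swap12 a12 (fun x y z => w x y z)).
have hW : W <= b * n ^+ 4.
  have -> : W = \sum_y \sum_z \sum_(t in nbrs y z) w t y z.
    rewrite /W /edge_sum exchange_big; apply: eq_bigr => y _.
    rewrite exchange_big; apply: eq_bigr => z _.
    rewrite [RHS]big_mkcond; apply: eq_bigr => x _; rewrite inE a12 a23.
    by case: (a y z x); rewrite ?mul1r ?mul0r.
  have -> : b * n ^+ 4 = \sum_(y : V) \sum_(z : V) b * n ^+ 2.
    have sumc (k : R) : \sum_(y : V) k = k * n by rewrite sumr_const mulr_natr.
    by rewrite sumc sumc -mulrA -mulrA -expr2 -exprD.
  by apply: ler_sum => y _; apply: ler_sum => z _; apply: sparse.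
(* Sum [inv_deg_ge] over the edges, trading [D x] for [n - d y z + w x y z]. *)
have hDel : 3 / 2 * (n * M - Del - W) <= 2 / 9 * n ^+ 4.
  have h1 : edge_sum a
       (fun x y z => 3 * n * 1 + (- 3) * d x y + (- (3 / 2)) * D x)
     <= edge_sum a (fun x y z => 2 / 9 * n ^+ 3 * (d x y * D x)^-1).
    apply: ler_edge_sum => x y z ha.
    by have := inv_deg_ge ha; rewrite mulr1 !mulNr.
  rewrite !(edge_sumD, edge_sumZ) -/M -/Del in h1.
  have h2 : edge_sum a (fun x y z => 3 * n * 1 + (- 3) * d x y + (- (3 / 2)) * (n * 1)
             + 3 / 2 * d y z + (- (3 / 2)) * w x y z)
     <= edge_sum a (fun x y z => 3 * n * 1 + (- 3) * d x y + (- (3 / 2)) * D x).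
    apply: ler_edge_sum => x y z _; have := deg_sum_le x y z; lra.
  rewrite !(edge_sumD, edge_sumZ) -/M eDel2 -/Del -/W in h2.
  have h3 : 2 / 9 * n ^+ 3 * edge_sum a (fun x y z =>
    (d x y * D x)^-1) <= 2 / 9 * n ^+ 4.
    have -> : 2 / 9 * n ^+ 4 = 2 / 9 * n ^+ 3 * n by rewrite -(mulrA (2 / 9)) -exprSr.
    apply: ler_wpM2l; last exact: edge_sum_inv_deg.
    by rewrite mulr_ge0 ?exprn_ge0 ?ler0n // divr_ge0 ?ler0n.
  have := le_trans h2 (le_trans h1 h3); lra.
pose Phi x y z := n * 1 + (-1) * d x y + (-1) * d y z + (-1) * d x z
   + w x y z + w y x z + w z x y.
(* Eliminating [Del] by [hDel] leaves at most [4 / 9 * n ^ 4 - 2 * n * M + 6 * W]; [dense] and [hW]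
   then give [8 = 2 + 6]. *)
have hPhi : edge_sum a Phi <= 8 * b * n ^+ 4.
  rewrite /Phi !(edge_sumD, edge_sumZ) -/M eDel2 eDel3 eW2 eW3 -/Del -/W.
  have : n * ((2 / 9 - b) * n ^+ 3) <= n * M by rewrite ler_wpM2l // ltW.
  have -> : n * ((2 / 9 - b) * n ^+ 3) = (2 / 9 - b) * n ^+ 4 by ring.
  lra.
have [/existsP[[[x y] z]] /= /andP[ha hz]|/existsPn h] :=
  boolP [exists t : V * V * V, a t.1.1 t.1.2 t.2 &&
     (Phi t.1.1 t.1.2 t.2 <= 81 * b * n)].
  by exists x, y, z; split=> //; move: hz; rewrite /Phi; lra.
(* Averaging: there are at least [n ^ 3 / 9] ordered edges, so values above [81 * b * n] on all of
   them would sum to at least [9 * b * n ^ 4]. *)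
have hM9 : n ^+ 3 / 9 <= M.
  apply: le_trans _ denseM.
  have : 0 <= (1 / 9 - b) * n ^+ 3 by rewrite mulr_ge0 ?exprn_ge0 ?subr_ge0 // ltW.
  lra.
have Mb : edge_sum a (fun x y z => 81 * b * n * 1) <= edge_sum a Phi.
  apply: ler_edge_sum => x y z ha; have := h (x, y, z).
  by rewrite ha /= -ltNge mulr1 => /ltW.
suff : edge_sum a Phi < edge_sum a (fun x y z => 81 * b * n * 1).
  by rewrite ltNge Mb.
apply: le_lt_trans hPhi _; rewrite edge_sumZ -/M.
have hc : 0 <= 81 * b * n by rewrite !mulr_ge0 // ltW.
apply: lt_le_trans (ler_wpM2l hc hM9).
have -> : 81 * b * n * (n ^+ 3 / 9) = 9 * (b * n ^+ 4) by field.
rewrite -mulrA ltr_pM2r ?mulr_gt0 ?exprn_gt0 //; lra.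
Qed.

(** Overlaps of the three neighbourhoods are counted by the [w] terms: a vertex [t] of [nbrs x z]
    has [xt] in [Q]. The Bonferroni inequality then bounds what the neighbourhoods miss. *)
Lemma balanced_edge_partition : exists x y z,
  #|~: (nbrs y z :|: nbrs x z :|: nbrs x y)|%:R <= 81 * b * n.
Proof.
have [x [y [z [ha h]]]] := exists_balanced_edge; exists x, y, z.
have sub (S T : {set V}) : S \subset T -> #|S|%:R <= #|T|%:R :> R.
  by move=> ST; rewrite ler_nat subset_leq_card.
have hAB : #|nbrs y z :&: nbrs x z|%:R <= w x y z.
  apply/sub/subsetP => t; rewrite !inE => /andP[-> h1] /=.
  by apply: aQ; rewrite -a23; apply: h1.
have hBC : #|nbrs x z :&: nbrs x y|%:R <= w y x z.
  apply/sub/subsetP => t; rewrite !inE => /andP[-> h1] /=.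
  by apply: (@aQ _ _ x); rewrite a23 a12.
have hCA : #|nbrs x y :&: nbrs y z|%:R <= w z x y.
  apply/sub/subsetP => t; rewrite !inE => /andP[-> h1] /=.
  by apply: (@aQ _ _ y); rewrite a23 a12.
have := card_setU3_ge R (nbrs y z) (nbrs x z) (nbrs x y).
have := cardsC (nbrs y z :|: nbrs x z :|: nbrs x y).
move/(congr1 (fun k => k%:R : R)); rewrite natrD; lra.
Qed.

Lemma stability : exists c : V -> 'I_3,
  #|[set t : V * V * V | a t.1.1 t.1.2 t.2
       && ~~ uniq [:: c t.1.1; c t.1.2; c t.2]]|%:R <= 495 * b * n ^+ 3.
Proof.
have [x [y [z]]] := balanced_edge_partition.
set A := nbrs y z; set B := nbrs x z; set C := nbrs x y; set L := ~: _ => hL.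
(* Overlaps go to the first class available, and the uncovered vertices [L] join the third. *)
pose c t : 'I_3 := if t \in A then inord 0 else if t \in B then inord 1 else inord 2.
exists c.
pose P (S : {set V}) := [set p : V * V | [&& p.1 \in S, p.2 \in S & Q p.1 p.2]].
have hP u v : #|P (nbrs u v)|%:R <= b * n ^+ 2.
  apply: le_trans (sparse u v); rewrite -natr_sum ler_nat -sum1_card.
  rewrite (eq_bigl (fun p : V * V =>
    (p.1 \in nbrs u v) && (p.2 \in nbrs u v :&: Qnbrs p.1))).
    rewrite -(pair_big_dep (fun t => t \in nbrs u v) (fun t r =>
      r \in nbrs u v :&: Qnbrs t) (fun _ _ => 1%N)) /=.
    by apply: leq_sum => t _; rewrite sum1_card.
  by move=> p; rewrite !inE.
pose X := [set p : V * V | (c p.1 == c p.2) && Q p.1 p.2].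
(* [165 = 3 + 2 * 81]: pairs inside one of [A], [B], [C], and ordered pairs with an end in [L]. *)
have hX : #|X|%:R <= 165 * b * n ^+ 2.
  have sX : X \subset P A :|: P B :|: P C :|: (setX L setT :|: setX setT L).
    apply/subsetP => -[p q]; rewrite !inE /= /c => /andP[hc ->]; move: hc.
    rewrite !inE; case: (a y z p); case: (a y z q); case: (a x z p);
      case: (a x z q); case: (a x y p); case: (a x y q) => //=;
      by move/eqP/(congr1 (@nat_of_ord 3)); rewrite !inordK.
  have : (#|X| <= #|P A| + #|P B| + #|P C| + (#|L| * #|V| + #|V| * #|L|))%N.
    apply: leq_trans (subset_leq_card sX) _; rewrite -[X in (X * #|L|)%N]cardsT.
    rewrite -[X in (#|L| * X)%N]cardsT -!cardsX.
    do 4![apply: leq_trans (leq_card_setU _ _) _; rewrite ?leq_add //].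
  rewrite -(ler_nat R) !(natrD, natrM).
  have := ler_wpM2r (ltW n0) hL; have := hP y z; have := hP x z; have := hP x y.
  rewrite -/A -/B -/C; lra.
have hT (f : V * V * V -> V * V * V) (T : {set V * V * V}) : injective f ->
    (forall t, t \in T -> (f t).1 \in X) -> #|T|%:R <= 165 * b * n ^+ 3.
  move=> f_inj fT; rewrite -(card_imset _ f_inj).
  have : f @: T \subset setX X setT.
    by apply/subsetP => _ /imsetP[t tT ->]; case: (f t) (fT t tT) => u v;
      rewrite !inE => ->.
  move/subset_leq_card; rewrite cardsX cardsT -(ler_nat R) natrM => h.
  apply: le_trans h _.
  have -> : 165 * b * n ^+ 3 = 165 * b * n ^+ 2 * n by ring.
  by apply: ler_wpM2r hX; apply: ltW.
(* Two vertices of equal colour in an edge form a pair of [X]; the three possible positions give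
   [495 = 3 * 165]. *)
pose T12 := [set t : V * V * V | a t.1.1 t.1.2 t.2 & c t.1.1 == c t.1.2].
pose T13 := [set t : V * V * V | a t.1.1 t.1.2 t.2 & c t.1.1 == c t.2].
pose T23 := [set t : V * V * V | a t.1.1 t.1.2 t.2 & c t.1.2 == c t.2].
have h12 : #|T12|%:R <= 165 * b * n ^+ 3.
  apply: (hT id) => // -[[p q] r]; rewrite !inE /= => /andP[hpqr ->].
  exact: aQ hpqr.
have h13 : #|T13|%:R <= 165 * b * n ^+ 3.
  apply: (hT (fun t => (t.1.1, t.2, t.1.2))) => [[[p q] r] [[p' q'] r'] /= [-> ->
    ->]//|].
  move=> -[[p q] r]; rewrite !inE /= a23 => /andP[hprq ->].
  exact: aQ hprq.
have h23 : #|T23|%:R <= 165 * b * n ^+ 3.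
  apply: (hT (fun t => (t.1.2, t.2, t.1.1))) => [[[p q] r] [[p' q'] r'] /= [-> ->
    ->]//|].
  move=> -[[p q] r]; rewrite !inE /= a12 a23 => /andP[hqrp ->].
  exact: aQ hqrp.
have : (#|[set t : V * V * V | a t.1.1 t.1.2 t.2
          && ~~ uniq [:: c t.1.1; c t.1.2; c t.2]]| <= #|T12| + #|T13| + #|T23|)%N.
  apply: leq_trans (leq_trans (leq_card_setU _ _) (leq_add (leq_card_setU T12 T13)
    (leqnn #|T23|))).
  apply: subset_leq_card; apply/subsetP => t; rewrite !inE /= !inE.
  by case: (a _ _ _); case: eqP; case: eqP; case: eqP.
rewrite -(ler_nat R) !natrD; lra.
Qed.
End Stability.

(** * Containers *)

(* Greedy removal of a vertex of degree more than [r].  The container [f T'] is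
   the same for every [T'] between [T] and [I], so that [T] can be recovered from a
   larger fingerprint. *)
Lemma graph_container (V : finType) (Q : rel V) (r : nat) (A : {set V}) :
  exists f : {set V} -> {set V},
    (forall T, \sum_(t in f T) #|f T :&: Qnbrs Q t| <= r * #|V|)%N /\
    forall I : {set V}, I \subset A -> {in I &, forall x y, ~~ Q x y} ->
      exists T : {set V}, [/\ T \subset I, (#|T| * r <= #|A|)%N &
        forall T' : {set V}, T \subset T' -> T' \subset I -> I \subset T' :|: f T'].
Proof.
have [k leAk] := ubnP #|A|; elim: k => // k IHk in A leAk *.
have [/existsP[v /andP[vA rv]]|/existsPn noV] :=
    boolP [exists v, (v \in A) && (r < #|A :&: Qnbrs Q v|)%N]; last first.
  exists (fun=> A); split=> [_|I IA _].
    apply: (@leq_trans (\sum_(t in A) r)).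
      by apply: leq_sum => t tA; have := noV t; rewrite tA /= -leqNgt.
    by rewrite sum_nat_const mulnC leq_mul2l max_card orbT.
  exists set0; rewrite sub0set cards0 mul0n; split=> // T' _ _.
  by rewrite subsetU // IA orbT.
have cAv : (#|A :\ v| < #|A|)%N by rewrite [in X in (_ < X)%N](cardsD1 v) vA.
have sAv : A :\ v :\: Qnbrs Q v \subset A :\ v by apply: subsetDl.
have [|f0 [sp0 hf0]] := IHk (A :\ v); first lia.
have [|f1 [sp1 hf1]] := IHk (A :\ v :\: Qnbrs Q v).
  by have := subset_leq_card sAv; lia.
(* Membership of [v] in [T] selects the branch. If [v] is in [I], its more than [r] neighbours leave
   [A], which pays for adding [v] to [T]; otherwise only [v] is dropped. *)
exists (fun T : {set V} => if v \in T then f1 (T :\ v) else f0 T);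
  split=> [T|I IA indI].
  by case: (v \in T).
have [vI|vNI] := boolP (v \in I); last first.
  have IAv : I \subset A :\ v by rewrite subsetD1 IA.
  have [T [TI cT hT]] := hf0 I IAv indI; exists T; split=> //.
    by apply: leq_trans cT _; apply: ltnW.
  move=> T' TT' T'I; rewrite ifN; first exact: hT.
  by apply: contra vNI; apply: (subsetP T'I).
have IAv : I :\ v \subset A :\ v :\: Qnbrs Q v.
  rewrite subsetD setSD //=; apply/pred0P => u /=; rewrite !inE.
  by apply/negP => /andP[/andP[_ uI] Qvu]; have := indI v u vI uI; rewrite Qvu.
have ind' : {in I :\ v &, forall x y, ~~ Q x y}.
  by move=> x y; rewrite !inE => /andP[_ xI] /andP[_ yI]; apply: indI.
have [T [TI cT hT]] := hf1 _ IAv ind'.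
exists (v |: T); split.
- by rewrite subUset sub1set vI (subset_trans TI) // subsetDl.
- have : (#|A :\ v :\: Qnbrs Q v| + r <= #|A|)%N.
    have -> : #|A| = (#|A :\: Qnbrs Q v| + #|A :&: Qnbrs Q v|)%N.
      by rewrite -[LHS](cardsID (Qnbrs Q v)) addnC.
    by rewrite leq_add ?(ltnW rv) // subset_leq_card // setSD // subsetDl.
  by have := cardsU1 v T; case: (v \notin T); nia.
- move=> T' vTT' T'I.
  have vT' : v \in T' by apply: (subsetP vTT'); rewrite setU11.
  have h1 : T \subset T' :\ v.
    apply/subsetP => u uT; rewrite !inE (subsetP vTT') ?inE ?uT ?orbT // andbT.
    by have := subsetP TI u uT; rewrite !inE => /andP[].
  have := hT _ h1 (setSD _ T'I); rewrite vT' => /subsetP hsub.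
  apply/subsetP => u uI; rewrite inE.
  have [->|uv] := eqVneq u v; first by rewrite vT'.
  by have := hsub u; rewrite !inE uv uI => /(_ isT).
Qed.

(** * Copies of [F5], fingerprints and containers of hypergraphs *)

Section Hypergraphs.
Variable V : finType.
Implicit Types (H G S : hypergraph V) (e : {set V}) (x y z : V).

Definition adj H x y z := [set x; y; z] \in H.

Lemma adj12 H x y z : adj H x y z = adj H y x z.
Proof. by rewrite /adj [[set x; y]]setUC. Qed.

Lemma adj23 H x y z : adj H x y z = adj H x z y.
Proof. by rewrite /adj setUAC. Qed.

Lemma card3_set3 e : #|e| = 3 -> exists x y z,
  [/\ e = [set x; y; z], x != y, x != z & y != z].
Proof.
move=> e3; have /set0Pn[x xe] : e != set0 by rewrite -card_gt0 e3.
have : #|e :\ x| == 2 by have := cardsD1 x e; rewrite xe e3 add1n => -[<-].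
case/cards2P=> y [z [yz ex]].
have : y \in e :\ x by rewrite ex !inE eqxx.
have : z \in e :\ x by rewrite ex !inE eqxx orbT.
rewrite !inE => /andP[zx _] /andP[yx _].
exists x, y, z; split=> //; try by rewrite eq_sym.
by rewrite -setUA -ex setD1K.
Qed.

Lemma cards3 x y z :
  (#|[set x; y; z]| == 3) = [&& x != y, x != z & y != z].
Proof.
rewrite setUC cardsU1 cards2 !inE negb_or ![_ == z]eq_sym.
by case: (x != y); case: (z != x); case: (z != y).
Qed.

Definition rainbow (c : V -> 'I_3) e :=
  [forall i : 'I_3, #|[set x in e | c x == i]| == 1].

Lemma rainbow_inj c e : rainbow c e -> {in e &, injective c}.
Proof.
move=> /forallP he x y xe ye cxy.
have /cards1P[u hu] := he (c x).
have : x \in [set u] by rewrite -hu inE xe /=.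
have : y \in [set u] by rewrite -hu inE ye cxy /=.
by rewrite !inE => /eqP-> /eqP->.
Qed.

Lemma rainbow_set3 c x y z :
  uniq [:: c x; c y; c z] -> rainbow c [set x; y; z].
Proof.
rewrite /= !inE !andbT negb_or => /andP[/andP[cxy cxz] cyz].
have cT : [set c x; c y; c z] = setT.
  apply/eqP; rewrite eqEcard subsetT cardsT card_ord.
  by rewrite setUC cardsU1 cards2 !inE negb_or ![c z == _]eq_sym cxy cxz cyz.
apply/forallP => i; apply/cards1P.
have : i \in [set c x; c y; c z] by rewrite cT inE.
have sing u : u \in [set x; y; z] ->
    {in [set x; y; z], forall v, c v = c u -> v = u} ->
    exists v, [set w in [set x; y; z] | c w == c u] = [set v].
  move=> ue hu; exists u; apply/setP => v; apply/setIdP/set1P => [[ve /eqP]|->//].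
  exact: hu.
rewrite !inE -orbA => /or3P[]/eqP->; apply: sing; rewrite ?inE ?eqxx ?orbT //;
  move=> v; rewrite !inE -orbA => /or3P[]/eqP-> // /eqP;
  by rewrite ?(negPf cxy) ?(negPf cxz) ?(negPf cyz) // eq_sym
    ?(negPf cxy) ?(negPf cxz) ?(negPf cyz).
Qed.

Definition rainbow_triples (c : V -> 'I_3) : hypergraph V :=
  [set e : {set V} | (#|e| == 3) && rainbow c e].

Lemma F5_edges :
  [/\ [set inord 0; inord 1; inord 2] \in F5,
      [set inord 0; inord 1; inord 3] \in F5 &
      [set inord 2; inord 3; inord 4] \in F5].
Proof. by rewrite /F5 !inE !eqxx ?orbT. Qed.

(** Any two of the vertices 0, 1, 2, 3 of [F5] lie in a common edge, so a copy would need four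
    colours. *)
Lemma rainbow_triangle_free c H :
  H \subset rainbow_triples c -> triangle_free H.
Proof.
move=> HT; apply/negP => /existsP[f /andP[/injectiveP f_inj /forall_inP fE]].
have [e1 e2 e3] := F5_edges.
have c_neq (u v : 'I_5) (e : {set 'I_5}) : e \in F5 -> u \in e -> v \in e -> u != v ->
  c (f u) != c (f v).
  move=> eF ue ve; apply: contra => /eqP cuv.
  have := subsetP HT _ (fE _ eF); rewrite inE => /andP[_ rb].
  by apply/eqP/f_inj/(rainbow_inj rb) => //; apply: imset_f.
have : uniq [seq c (f i) | i <- [:: inord 0; inord 1; inord 2; inord 3]].
  rewrite /= !inE !negb_or.
  rewrite (c_neq _ _ _ e1) ?(c_neq (inord 0) (inord 2) _ e1) ?(c_neq (inord 0) (inord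
    3) _ e2)
   ?(c_neq (inord 1) (inord 2) _ e1) ?(c_neq (inord 1) (inord 3) _ e2) ?(c_neq (inord
     2) (inord 3) _ e3) //;
  by rewrite ?inE ?eqxx ?orbT // -val_eqE /= !inordK.
by move/card_uniqP => h; have := max_card [in [seq c (f i) | i <- [:: inord 0; inord 1;
  inord 2; inord 3]]];
  rewrite h card_ord.
Qed.

Lemma has_copy_F5 H (v0 v1 v2 v3 v4 : V) : uniq [:: v0; v1; v2; v3; v4] ->
  adj H v0 v1 v2 -> adj H v0 v1 v3 -> adj H v2 v3 v4 -> has_copy F5 H.
Proof.
move=> us h1 h2 h3; apply/existsP.
exists [ffun i : 'I_5 => nth v0 [:: v0; v1; v2; v3; v4] i]; apply/andP; split.
  apply/injectiveP => i j; rewrite !ffunE => /eqP.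
  by rewrite nth_uniq // => /eqP/val_inj.
apply/forall_inP => e; rewrite !inE -orbA => /or3P[]/eqP->;
  by rewrite !imsetU !imset_set1 !ffunE !inordK.
Qed.

(** Codegree 3 is what leaves a third vertex available after two given vertices are excluded. *)
Definition codegree_ge3 H : {set V * V} :=
  [set p | 2 < #|nbrs (adj H) p.1 p.2|]%N.

(** If [w] and [w'] in [nbrs x y] had codegree 3, some edge [ww'z] would avoid [x] and [y], and
    [xyw], [xyw'], [ww'z] would form [F5]. *)
Lemma nbrs_independent H x y : uniform 3 H -> triangle_free H ->
  {in nbrs (adj H) x y &, forall w w', (w, w') \notin codegree_ge3 H}.
Proof.
move=> /forall_inP uH tfH w w'; rewrite !inE -leqNgt /= => hw hw'.
rewrite leqNgt; apply: contra tfH => h.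
have /set0Pn[z] : nbrs (adj H) w w' :\: [set x; y] != set0.
  rewrite -card_gt0 cardsD subn_gt0; apply: leq_ltn_trans h.
  by apply: leq_trans (subset_leq_card (subsetIr _ _)) _; rewrite cards2;
    case: (x != y).
rewrite !inE negb_or => /andP[/andP[zx zy] hz].
have := uH _ hw; have := uH _ hw'; have := uH _ hz; rewrite !cards3.
move=> /and3P[ww' wz w'z] /and3P[xy xw' yw'] /and3P[_ xw yw].
apply: has_copy_F5 hw hw' hz; rewrite /= !inE !negb_or.
by rewrite xy xw xw' yw yw' ww' wz w'z ![_ == z]eq_sym zx zy.
Qed.

(** All orderings of [e] are tested, so all its pairs lie in [Q]. Only [f], [Q] and [S] enter, which
    is what allows a union bound. *)
Definition container (f : {set V} -> {set V}) (Q : {set V * V}) S : hypergraph V :=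
  [set e : {set V} | (#|e| == 3) && [forall x, forall y, forall z, (e == [set x; y;
    z]) ==>
     ((x, y) \in Q) && (z \in f (nbrs (adj S) x y))]].

Lemma containerP f Q S x y z : adj (container f Q S) x y z ->
  (x, y) \in Q /\ z \in f (nbrs (adj S) x y).
Proof.
rewrite /adj inE => /andP[_ /forallP/(_ x)/forallP/(_ y)/forallP/(_ z)].
by rewrite eqxx => /andP.
Qed.

(** [S] collects the graph fingerprints of neighbourhoods of pairs in [Q], and all edges on pairs
    outside [Q], at most two per pair. Since other pairs contribute too, [nbrs (adj S) x y] may
    exceed [T (x, y)]; hence the demand that [f] work for every [T'] between [T] and [I]. *)
Lemma container_cover H (f : {set V} -> {set V}) t : (1 < t)%N -> uniform 3 H ->
  (forall I : {set V}, {in I &, forall w w', (w, w') \notin codegree_ge3 H} ->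
      exists T : {set V}, [/\ T \subset I, (#|T| <= t)%N &
        forall T' : {set V}, T \subset T' -> T' \subset I -> I \subset T' :|: f T']) ->
  triangle_free H ->
  exists S, [/\ S \subset H, (#|S| <= #|V| ^ 2 * t)%N &
    H :\: S \subset container f (codegree_ge3 H) S].
Proof.
move=> t1 uH hf tfH.
have /fin_all_exists[T hT] (p : V * V) : exists T : {set V},
    [/\ T \subset nbrs (adj H) p.1 p.2, (#|T| <= t)%N &
        forall T' : {set V}, T \subset T' -> T' \subset nbrs (adj H) p.1 p.2 ->
          nbrs (adj H) p.1 p.2 \subset T' :|: f T'].
  exact/hf/nbrs_independent.
pose U (p : V * V) := if p \in codegree_ge3 H then T p else nbrs (adj H) p.1 p.2.
have UH p : U p \subset nbrs (adj H) p.1 p.2.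
  by rewrite /U; case: ifP => // _; have [] := hT p.
pose S : hypergraph V := \bigcup_p [set [set p.1; p.2; w] | w in U p].
have SU x y w : w \in U (x, y) -> [set x; y; w] \in S.
  by move=> wU; apply/bigcupP; exists (x, y) => //; apply: imset_f.
have SH : S \subset H.
  apply/bigcupsP => p _; apply/subsetP => _ /imsetP[w /(subsetP (UH p)) + ->].
  by rewrite inE.
exists S; split=> //.
  have -> : (#|V| ^ 2 * t)%N = (\sum_(p : V * V) t)%N.
    by rewrite sum_nat_const card_prod mulnn.
  rewrite /S; elim/big_ind2: _ => [|a A b B hA hB|p _]; first by rewrite cards0.
    by apply: leq_trans (leq_add hA hB); rewrite leq_card_setU.
  apply: leq_trans (leq_imset_card _ _) _; rewrite /U.
  case: ifPn => [_|]; first by have [] := hT p.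
  by rewrite inE -leqNgt => /leq_trans->.
apply/subsetP => e; rewrite inE => /andP[eS eH].
rewrite inE (forall_inP uH e eH) /=.
apply/forallP => x; apply/forallP => y; apply/forallP => z; apply/implyP => /eqP ee.
have zN : z \in nbrs (adj H) x y by rewrite inE /adj -ee.
have xyQ : (x, y) \in codegree_ge3 H.
  apply: contraNT eS => xyQ; rewrite ee; apply: SU.
  by rewrite /U (negPf xyQ).
rewrite xyQ; have [_ _ /(_ (nbrs (adj S) x y)) hxy] := hT (x, y).
have h1 : T (x, y) \subset nbrs (adj S) x y.
  by apply/subsetP => w wT; rewrite inE; apply: SU; rewrite /U xyQ.
have h2 : nbrs (adj S) x y \subset nbrs (adj H) x y.
  by apply/subsetP => w; rewrite !inE; apply: (subsetP SH).
have := subsetP (hxy h1 h2) z zN; rewrite inE => /orP[|//].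
by rewrite inE /adj -ee (negPf eS).
Qed.

Lemma card_ordered_triples G : {in G, forall e, #|e| = 3} ->
  (6 * #|G| <= #|[set t : V * V * V | adj G t.1.1 t.1.2 t.2]|)%N.
Proof.
move=> G3; rewrite -[X in (_ <= X)%N]sum1_card.
rewrite (partition_big (fun t : V * V * V => [set t.1.1; t.1.2; t.2]) [in G]) /=;
  last first.
  by move=> t; rewrite inE.
rewrite mulnC -sum_nat_const; apply: leq_sum => e eG.
have [x [y [z [ee xy xz yz]]]] := card3_set3 (G3 e eG).
rewrite sum1_card.
pose s := [:: (x, y, z); (x, z, y); (y, x, z); (y, z, x); (z, x, y); (z, y, x)].
have us : uniq s.
  rewrite /s /= !inE !xpair_eqE ?eqxx (negPf xy) (negPf xz) (negPf yz).
  by rewrite ![y == x]eq_sym ![z == x]eq_sym ![z == y]eq_sym (negPf xy) (negPf xz)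
    (negPf yz).
have s6 : #|s| = 6 by apply/card_uniqP.
rewrite -[X in (X <= _)%N]s6; apply: subset_leq_card; apply/subsetP => t st.
suff et : [set t.1.1; t.1.2; t.2] = e by rewrite unfold_in /= /adj inE et eG eqxx.
rewrite ee; move: st; rewrite !inE => /or4P[/eqP->|/eqP->|/eqP->|/or3P[]/eqP->] //=;
 by apply/setP => u; rewrite !inE; case: (u == x); case: (u == y); case: (u == z).
Qed.

(** Density [2 / 9] in ordered triples means [n ^ 3 / 27] edges. The conclusion uses one ordering
    per edge, giving up a factor 6. *)
Lemma hypergraph_stability (R : realFieldType) (b : R) (Q : rel V) G :
  0 < b -> b <= 1 / 9 -> (0 < #|V|)%N ->
  {in G, forall e, #|e| = 3} -> (forall x y z, adj G x y z -> Q x y) ->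
  (forall x y, \sum_(t in nbrs (adj G) x y)
      #|nbrs (adj G) x y :&: Qnbrs Q t|%:R <= b * #|V|%:R ^+ 2) ->
  (2 / 9 - b) * #|V|%:R ^+ 3 <= 6 * #|G|%:R ->
  exists c : V -> 'I_3,
    #|[set e in G | ~~ rainbow c e]|%:R <= 495 * b * #|V|%:R ^+ 3.
Proof.
move=> b0 b9 V0 G3 GQ sparse dense.
have [||c hc] := stability (adj12 G) (adj23 G) GQ b0 b9 sparse.
- apply: le_trans dense _; rewrite edge_sum1 -natrM ler_nat.
  exact: card_ordered_triples.
- by rewrite ltr0n.
exists c; apply: le_trans hc; rewrite ler_nat.
apply: (leq_trans _ (leq_imset_card (fun t : V * V * V => [set t.1.1; t.1.2; t.2]) _)).
apply: subset_leq_card; apply/subsetP => e; rewrite inE => /andP[eG erb].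
have [x [y [z [ee _ _ _]]]] := card3_set3 (G3 e eG).
apply/imsetP; exists (x, y, z) => //; rewrite !inE /= /adj -ee eG /=.
by apply: contra erb => hu; rewrite ee rainbow_set3.
Qed.

Lemma container_stability (R : realFieldType) (b : R) r (f : {set V} ->
  {set V}) (Q : {set V * V}) S :
  0 < b -> b <= 1 / 9 -> (0 < #|V|)%N -> r%:R <= b * #|V|%:R ->
  (forall T, \sum_(t in f T) #|f T :&: Qnbrs (fun x y =>
    (x, y) \in Q) t| <= r * #|V|)%N ->
  (2 / 9 - b) * #|V|%:R ^+ 3 <= 6 * #|container f Q S|%:R ->
  exists c : V -> 'I_3,
    #|[set e in container f Q S | ~~ rainbow c e]|%:R <= 495 * b * #|V|%:R ^+ 3.
Proof.
move=> b0 b9 V0 rb spf dense.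
apply: (@hypergraph_stability R b (fun x y => (x, y) \in Q) _ b0 b9 V0 _ _ _ dense).
- by move=> e; rewrite inE => /andP[/eqP].
- by move=> x y z /containerP[].
- move=> x y; rewrite -natr_sum.
  apply: (@le_trans _ _ (r * #|V|)%:R).
    rewrite ler_nat; apply: leq_trans (spf (nbrs (adj S) x y)).
    have sub : nbrs (adj (container f Q S)) x y \subset f (nbrs (adj S) x y).
      by apply/subsetP => z; rewrite inE => /containerP[].
    rewrite big_mkcond [X in (_ <= X)%N]big_mkcond; apply: leq_sum => t _.
    case: ifPn => // tN; rewrite (subsetP sub _ tN).
    by apply/subset_leq_card/setSI.
  by rewrite natrM expr2 mulrA ler_wpM2r // ler0n.
Qed.

End Hypergraphs.

(** * Counting subsets *)

Section Counting.
Variable R : realType.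

Lemma sum_subset_expr (E : finType) (X : {set E}) (x : R) :
  \sum_(S : {set E} | S \subset X) x ^+ #|S| = (1 + x) ^+ #|X|.
Proof.
rewrite addrC exprD1n.
rewrite (partition_big (fun S : {set E} => inord #|S| : 'I_(#|X|.+1)) xpredT) //=.
apply: eq_bigr => k _.
rewrite (eq_bigl (mem [set S : {set E} | S \subset X & #|S| == k])); last first.
  move=> S; rewrite !inE; case SX: (S \subset X) => //=.
  by rewrite -val_eqE /= inordK // ltnS subset_leq_card.
rewrite (eq_bigr (fun=> x ^+ k)); last by move=> S; rewrite /= !inE => /andP[_ /eqP->].
by rewrite sumr_const cards_draws.
Qed.

(* Exponential tilting: [kap > 0] bounds a sum over small sets, [kap < 0] a
   sum over large ones. *)
Lemma sum_subset_tilt (E : finType) (X : {set E}) (P : pred {set E})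
    (rho kap theta : R) : 0 <= rho ->
  (forall S, P S -> kap * #|S|%:R <= kap * theta) ->
  \sum_(S : {set E} | (S \subset X) && P S) rho ^+ #|S|
    <= expR (kap * theta + expR (- kap) * (rho * #|X|%:R)).
Proof.
(* With [rho = expR kap * y], the factor [expR (kap * #|S|)] is at most [expR (kap * theta)] on [P];
   the rest is summed over all subsets of [X]. *)
move=> rho0 hP; pose y := expR (- kap) * rho.
have y0 : 0 <= y by rewrite mulr_ge0 ?expR_ge0.
have h1 (S : {set E}) : (S \subset X) && P S ->
    rho ^+ #|S| <= expR (kap * theta) * y ^+ #|S|.
  case/andP=> _ /hP hS; have -> : rho = expR kap * y.
    by rewrite mulrA -expRD subrr expR0 mul1r.
  rewrite exprMn ler_wpM2r ?exprn_ge0 // -expRM_natl ler_expR.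
  by rewrite mulrC.
apply: le_trans (ler_sum _ h1) _; rewrite -mulr_sumr expRD.
rewrite ler_wpM2l ?expR_ge0 //.
apply: (@le_trans _ _ ((1 + y) ^+ #|X|)).
  rewrite -sum_subset_expr [X in _ <= X](bigID P) /= lerDl.
  by apply: sumr_ge0 => S _; apply: exprn_ge0.
rewrite mulrA [X in expR X]mulrC expRM_natl.
by rewrite lerXn2r ?nnegrE ?expR_ge0 ?expR_ge1Dx // addr_ge0.
Qed.

(** For [k < m] the ratio ['C(K, k) / 'C(K, k.+1) = (k + 1) / (K - k)] is at most [m / (K - m)].
    Prescribing [t] edges thus costs [rho ^+ t]. *)
Lemma bin_sub_le (K m t : nat) (rho : R) : 0 <= rho -> (t <= m)%N -> (m < K)%N ->
  m%:R <= rho * (K - m)%:R -> 'C(K, m - t)%:R <= rho ^+ t * 'C(K, m)%:R.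
Proof.
move=> rho0 + mK hrho; elim: t => [|t IHt] tm; first by rewrite subn0 expr0 mul1r.
rewrite exprS -mulrA; apply: le_trans (ler_wpM2l rho0 (IHt (ltnW tm))).
set k := (m - t.+1)%N; have -> : (m - t)%N = k.+1 by rewrite /k; lia.
have Km : 0 < (K - m)%:R :> R by rewrite ltr0n subn_gt0.
rewrite -(ler_pM2l Km) mulrA [_ * rho]mulrC.
apply: (@le_trans _ _ (m%:R * 'C(K, k.+1)%:R)); last by rewrite ler_wpM2r ?ler0n.
rewrite -!natrM ler_nat.
apply: (@leq_trans ((K - k) * 'C(K, k))); first by rewrite leq_mul2r; apply/orP; right;
  lia.
by rewrite -mul_bin_left leq_mul2r; apply/orP; right; rewrite /k; lia.
Qed.

(** The quotient of the binomials is a product of ratios [(g - i) / (K - i)], each at most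
    [1 - ep]. *)
Lemma bin_shrink (g K j : nat) (ep : R) : 0 <= ep <= 1 -> g%:R <= (1 - ep) * K%:R ->
  'C(g, j)%:R <= (1 - ep) ^+ j * 'C(K, j)%:R.
Proof.
case/andP=> ep0 ep1 hg; elim: j => [|j IHj]; first by rewrite !bin0 expr0 mul1r.
have j0 : 0 < j.+1%:R :> R by rewrite ltr0n.
rewrite -(ler_pM2l j0) mulrCA -!natrM !mul_bin_left !natrM exprSr.
have -> : (1 - ep) ^+ j * (1 - ep) * ((K - j)%:R * 'C(K, j)%:R) =
  ((1 - ep) * (K - j)%:R) * ((1 - ep) ^+ j * 'C(K, j)%:R) by ring.
apply: ler_pM; rewrite ?ler0n //.
have [gj|jg] := leqP g j.
  have -> : (g - j)%N = 0 by lia.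
  by rewrite mulr_ge0 ?ler0n // subr_ge0.
have gK : (g <= K)%N.
  rewrite -(ler_nat R); apply: le_trans hg _; rewrite -[X in _ <= X]mul1r.
  by rewrite ler_wpM2r ?ler0n // gerBl.
rewrite !natrB; try lia.
have : 0 <= ep * j%:R by rewrite mulr_ge0 ?ler0n.
lra.
Qed.

Lemma card_le_cover (T I : finType) (A : {set T}) (p : pred I) (F : I -> {set T}) :
  (forall H, H \in A -> exists2 i, p i & H \in F i) ->
  (#|A| <= \sum_(i | p i) #|F i|)%N.
Proof.
move=> hA; rewrite -sum1_card.
have -> : (\sum_(i | p i) #|F i| = \sum_H \sum_(i | p i) (H \in F i : nat))%N.
  rewrite exchange_big; apply: eq_bigr => i _.
  by rewrite -sum1_card big_mkcond; apply: eq_bigr => H _; case: (H \in F i).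
rewrite big_mkcond; apply: leq_sum => H _; case: ifP => // /hA[i pi HF].
by rewrite (bigD1 i) //= HF.
Qed.

(** * Hypergraphs sharing one fingerprint *)

Section FixedFingerprint.
Variables (E : finType) (m K : nat) (S : {set E}) (rho : R).
Variable HH : {set {set E}}.
Hypothesis HHm : {in HH, forall H : {set E}, #|H| = m /\ S \subset H}.
Hypothesis rho0 : 0 <= rho.
Hypothesis mK : (m < K)%N.
Hypothesis rhoP : m%:R <= rho * (K - m)%:R.

(** [H] is determined by [H :\: S], a subset of [G] of size [m - #|S|]. Replacing [K] by [#|G|]
    gains [1 - ep] per element; returning from [m - #|S|] to [m] costs [rho ^+ #|S|]. *)
Lemma count_small_container (G : {set E}) (ep : R) : 0 <= ep <= 1 ->
  #|G|%:R <= (1 - ep) * K%:R -> {in HH, forall H : {set E}, H :\: S \subset G} ->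
  #|HH|%:R <= rho ^+ #|S| * 'C(K, m)%:R * expR (- (ep * (m%:R - #|S|%:R))).
Proof.
move=> ep01 hG HG.
have [->|/set0Pn[H0 /HHm[H0m SH0]]] := eqVneq HH set0.
  by rewrite cards0 mulr_ge0 ?expR_ge0 // mulr_ge0 ?exprn_ge0 ?ler0n.
have Sm : (#|S| <= m)%N by rewrite -H0m subset_leq_card.
have inj : {in HH &, injective (fun H : {set E} => H :\: S)}.
  move=> H1 H2 /HHm[_ S1] /HHm[_ S2] e12.
  by rewrite -(setID H1 S) -(setID H2 S) e12 !(setIidPr _).
have : (#|HH| <= 'C(#|G|, m - #|S|))%N.
  rewrite -(card_in_imset inj) -cards_draws; apply: subset_leq_card.
  apply/subsetP => _ /imsetP[H HHH ->]; rewrite inE HG //=.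
  by have [Hm SH] := HHm HHH; rewrite cardsD (setIidPr SH) Hm.
rewrite -(ler_nat R) => h; apply: le_trans h _.
apply: le_trans (bin_shrink _ ep01 hG) _.
rewrite mulrC; apply: ler_pM; rewrite ?ler0n ?exprn_ge0 ?subr_ge0 //.
- by case/andP: ep01.
- exact: bin_sub_le.
rewrite -mulrN -natrB // mulrC mulNr -mulrN expRM_natl.
rewrite lerXn2r ?nnegrE ?expR_ge0 ?subr_ge0 //; first by case/andP: ep01.
exact: expR_ge1Dx.
Qed.

(** Sum over the trace [J] of [H :\: S] on [B]. The remaining edges lie in [G0], so [J] costs
    [rho ^+ #|J|]; tilting by [- kap] exploits that [J] has at least [j0] elements. *)
Lemma count_split_container (G0 B : {set E}) (kap j0 : R) : 0 <= kap ->
  (#|G0| <= K)%N -> {in HH, forall H : {set E}, H :\: S \subset G0 :|: B} ->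
  {in HH, forall H : {set E}, j0 <= #|(H :\: S) :&: B|%:R} ->
  #|HH|%:R <= rho ^+ #|S| * 'C(K, m)%:R
    * expR (- (kap * j0) + expR kap * (rho * #|B|%:R)).
Proof.
move=> kap0 hG0 HG Hj.
have : (#|HH| <= \sum_(J : {set E} | (J \subset B) && (j0 <= #|J|%:R)%R)
   #|[set H in HH | (H :\: S) :&: B == J]|)%N.
  apply: card_le_cover => H HHH; exists ((H :\: S) :&: B).
    by rewrite subsetIr Hj.
  by rewrite inE HHH eqxx.
rewrite -(ler_nat R) natr_sum => h; apply: le_trans h _.
have hJ (J : {set E}) : (J \subset B) && (j0 <= #|J|%:R) ->
   #|[set H in HH | (H :\: S) :&: B == J]|%:R <= rho ^+ #|S| * 'C(K, m)%:R * rho ^+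
     #|J|.
  move=> _; set F := [set H in HH | _].
  have [->|/set0Pn[H0]] := eqVneq F set0.
    by rewrite cards0 mulr_ge0 ?exprn_ge0 // mulr_ge0 ?exprn_ge0 ?ler0n.
  rewrite inE => /andP[/HHm[H0m SH0] /eqP JE].
  have cJ (H : {set E}) : S \subset H -> (H :\: S) :&: B = J ->
    #|H| = (#|S| + #|J| + #|H :\: S :\: B|)%N.
    by move=> SH <-; rewrite -[LHS](cardsID S) (setIidPr SH) -[#|H :\: S|](cardsID B)
      addnA.
  have Sm : (#|S| + #|J| <= m)%N by rewrite -H0m (cJ H0 SH0 JE) leq_addr.
  have inj : {in F &, injective (fun H : {set E} => H :\: S :\: B)}.
    move=> H1 H2; rewrite !inE =>
      /andP[/HHm[_ S1] /eqP J1] /andP[/HHm[_ S2] /eqP J2] e12.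
    rewrite -(setID H1 S) -(setID H2 S) !(setIidPr _) //.
    by rewrite -(setID (H1 :\: S) B) -(setID (H2 :\: S) B) J1 J2 e12.
  have : (#|F| <= 'C(#|G0|, m - (#|S| + #|J|)))%N.
    rewrite -(card_in_imset inj) -cards_draws; apply: subset_leq_card.
    apply/subsetP => Y /imsetP[H]; rewrite !inE => /andP[HHH /eqP HJ] ->.
    have [Hm SH] := HHm HHH; have := cJ H SH HJ; rewrite Hm => ->.
    by rewrite addKn eqxx andbT subDset setUC HG.
  move=> hF; rewrite mulrAC -exprD; apply: le_trans (bin_sub_le rho0 Sm mK rhoP).
  by rewrite ler_nat; apply: leq_trans hF _; apply: leq_bin2l.
apply: le_trans (ler_sum _ hJ) _; rewrite -mulr_sumr.
rewrite ler_wpM2l ?mulr_ge0 ?exprn_ge0 ?ler0n //.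
have := @sum_subset_tilt E B (fun J => j0 <= #|J|%:R) rho (- kap) j0 rho0.
rewrite opprK mulNr; apply => J hJ'.
by rewrite !mulNr lerN2 ler_wpM2l.
Qed.
End FixedFingerprint.
End Counting.

(** * Hypergraphs far from tripartite *)

Section RainbowNumber.
Variable n : nat.

(** An exact maximum, because a constant relative error would change ['C(max_rainbow, m)] by a
    factor exponential in [m]. *)
Definition max_rainbow : nat :=
  (\max_(c : {ffun 'I_n -> 'I_3}) #|rainbow_triples c|)%N.

Lemma eq_rainbow (V : finType) (c1 c2 : V -> 'I_3) : c1 =1 c2 ->
  rainbow c1 =1 rainbow c2.
Proof.
move=> ec e; apply: eq_forallb => i; congr (_ == _); apply: eq_card => x.
by rewrite !inE ec.
Qed.

Lemma rainbow_le_max (c : 'I_n -> 'I_3) : (#|rainbow_triples c| <= max_rainbow)%N.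
Proof.
have -> : rainbow_triples c = rainbow_triples [ffun x => c x].
  by apply/setP => e; rewrite !inE (eq_rainbow (ffunE c)).
rewrite /max_rainbow; exact: (leq_bigmax [ffun x => c x]).
Qed.

(** All subsets of one largest tripartite hypergraph are triangle-free; the later counts are
    measured against this lower bound. *)
Lemma bin_max_rainbow_le m : ('C(max_rainbow, m) <= #|triangle_free_hypergraphs n m|)%N.
Proof.
rewrite /max_rainbow; have [|c ->] := bigop.eq_bigmax (fun c : {ffun 'I_n -> 'I_3} =>
  #|rainbow_triples c|).
  by apply/card_gt0P; exists [ffun=> ord0].
rewrite -cards_draws; apply: subset_leq_card; apply/subsetP => H.
rewrite !inE => /andP[HT ->]; rewrite (rainbow_triangle_free HT) !andbT.
by apply/forall_inP => e /(subsetP HT); rewrite inE => /andP[].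
Qed.

(** The classes are the residues modulo 3, and [F] lists transversal triples of vertices
    [3 * a + j]. *)
Lemma max_rainbow_ge : ((n %/ 3) ^ 3 <= max_rainbow)%N.
Proof.
set k := (n %/ 3)%N; have kn : (k * 3 <= n)%N by apply: leq_trunc_div.
have lt3 (i j : nat) : (i < k -> j < 3 -> i * 3 + j < n)%N by lia.
pose v (a : 'I_k) (j : 'I_3) : 'I_n := Ordinal (lt3 a j (ltn_ord a) (ltn_ord j)).
pose c (u : 'I_n) : 'I_3 := inord (u %% 3).
have cv a j : c (v a j) = j.
  by apply: val_inj; rewrite /= inordK ?ltn_mod // modnMDl modn_small.
pose F (p : 'I_k * 'I_k * 'I_k) : {set 'I_n} :=
  [set v p.1.1 (inord 0); v p.1.2 (inord 1); v p.2 (inord 2)].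
have v_inj a a' j j' : v a j = v a' j' -> a = a' /\ j = j'.
  move=> e; have ej : j = j' by rewrite -(cv a j) -(cv a' j') e.
  split=> //; apply: val_inj; move/(congr1 val): e; rewrite ej /= => /eqP.
  by rewrite eqn_add2r eqn_mul2r => /eqP.
have i01 : (inord 0 == inord 1 :> 'I_3) = false by rewrite -val_eqE /= !inordK.
have i02 : (inord 0 == inord 2 :> 'I_3) = false by rewrite -val_eqE /= !inordK.
have i12 : (inord 1 == inord 2 :> 'I_3) = false by rewrite -val_eqE /= !inordK.
have i10 : (inord 1 == inord 0 :> 'I_3) = false by rewrite eq_sym.
have i20 : (inord 2 == inord 0 :> 'I_3) = false by rewrite eq_sym.
have i21 : (inord 2 == inord 1 :> 'I_3) = false by rewrite eq_sym.
have F_inj : injective F.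
  move=> [[x y] z] [[x' y'] z'] /setP e.
  have /= := e (v x (inord 0)); have /= := e (v y (inord 1));
    have /= := e (v z (inord 2)).
  rewrite !inE !eqxx !orbT /= => /esym + /esym + /esym.
  have vne a a' (j j' : 'I_3) : (j == j') = false -> (v a j == v a' j') = false.
    by move=> jj'; apply/negP => /eqP/v_inj[_ ejj']; rewrite ejj' eqxx in jj'.
  rewrite !(vne _ _ _ _ i01, vne _ _ _ _ i02, vne _ _ _ _ i12).
  rewrite !(vne _ _ _ _ i10, vne _ _ _ _ i20, vne _ _ _ _ i21) ?orbF.
  by do 3![move=> /eqP/v_inj[-> _]].
apply: leq_trans (rainbow_le_max c).
have -> : (k ^ 3 = #|F @: setT|)%N.
  by rewrite card_imset // cardsT !card_prod card_ord expnSr mulnn.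
apply: subset_leq_card; apply/subsetP => _ /imsetP[[[x y] z] _ ->].
have rb : rainbow c (F (x, y, z)).
  by apply: rainbow_set3; rewrite /= !cv !inE i01 i02 i12.
rewrite inE rb andbT cards3 /=.
by apply/and3P; split; apply/eqP => /v_inj[_ /eqP]; rewrite ?i01 ?i02 ?i12.
Qed.

Lemma max_rainbow_asymp (R : realFieldType) (eta : R) : 0 < eta -> 6 <= eta * n%:R ->
  (1 - eta) * n%:R ^+ 3 <= 27 * max_rainbow%:R.
Proof.
move=> eta0 hn.
have h1 : ((n - 2) ^ 3 <= 27 * max_rainbow)%N.
  have h : (n - 2 <= 3 * (n %/ 3))%N.
    by have := divn_eq n 3; have := ltn_pmod n (isT : 0 < 3)%N; lia.
  apply: (@leq_trans ((3 * (n %/ 3)) ^ 3)); first by rewrite leq_exp2r.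
  by rewrite expnMn leq_mul // max_rainbow_ge.
have n0 : 0 <= n%:R :> R by [].
(* For [n < 2] the hypothesis forces [eta >= 3], and the left side is nonpositive. *)
have [n2|n2] := ltnP n 2.
  have : n%:R <= 2 :> R by rewrite ler_nat ltnW.
  move=> n2'; apply: (@le_trans _ _ 0); last by rewrite mulr_ge0 ?ler0n.
  rewrite mulrC mulr_ge0_le0 ?exprn_ge0 //; nra.
move: h1; rewrite -(ler_nat R) natrX natrM natrB // => h1; apply: le_trans h1.
have : 6 * n%:R ^+ 2 <= eta * n%:R ^+ 3.
  by rewrite [n%:R ^+ 3]exprS mulrA ler_wpM2r ?exprn_ge0.
have -> : (n%:R - 2) ^+ 3 = n%:R ^+ 3 - 6 * n%:R ^+ 2 + 12 * n%:R - 8 :> R by ring.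
have : 2 <= n%:R :> R by rewrite ler_nat.
lra.
Qed.

End RainbowNumber.

Lemma bin3_le k : ('C(k, 3) <= k ^ 3)%N.
Proof.
apply: (@leq_trans ('C(k, 3) * 3`!)%N); first by rewrite leq_pmulr ?fact_gt0.
rewrite bin_ffact (ffactnS _ 2) (ffactnS _ 1) (ffactnS _ 0) ffactn0 muln1.
rewrite (expnS _ 2) (expnS _ 1) expn1 !leq_mul ?leq_pred //.
exact: leq_trans (leq_pred _) (leq_pred _).
Qed.

Section Bad.
Variables (R : realType) (n m : nat) (delta : R).

Definition far_from_tripartite : {set hypergraph 'I_n} :=
  [set H in triangle_free_hypergraphs n m
     | ~~ tripartite_after_removing (delta * m%:R) H].

Local Notation bad := far_from_tripartite.

(** Otherwise deleting [S] and the non-rainbow edges would make [H] tripartite at a cost below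
    [delta * m]. *)
Lemma far_nonrainbow (H G S : hypergraph 'I_n) (c : 'I_n -> 'I_3) :
  H \in bad -> S \subset H -> H :\: S \subset G ->
  delta * m%:R - #|S|%:R <= #|(H :\: S) :&: [set e in G | ~~ rainbow c e]|%:R.
Proof.
rewrite !inE => /andP[_ far] SH HG; rewrite leNgt; apply: contra far => h.
set J := (H :\: S) :&: _ in h; apply/existsP; exists (S :|: J); apply/and3P; split.
- by rewrite subUset SH /J (subset_trans (subsetIl _ _)) // subsetDl.
- apply: (@le_trans _ _ (#|S|%:R + #|J|%:R)); last lra.
  by rewrite -natrD ler_nat leq_card_setU.
- apply/existsP; exists [ffun x => c x]; apply/forall_inP => e.
  rewrite !inE negb_or => /andP[/andP[eS eJ] eH].
  have eG : e \in G by apply: (subsetP HG); rewrite inE eS.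
  suff : rainbow c e by rewrite -(eq_rainbow (ffunE c)).
  by move: eJ; rewrite eS eH eG /= negbK.
Qed.

Section Fingerprint.
Variables (b : R) (r s0 : nat) (f : {set 'I_n} -> {set 'I_n}) (Q : {set 'I_n * 'I_n}).
Variable S : hypergraph 'I_n.
Hypothesis b0 : 0 < b.
Hypothesis b9 : b <= 1 / 9.
Hypothesis n0 : (0 < n)%N.
Hypothesis rb : r%:R <= b * n%:R.
Hypothesis spf : forall T, (\sum_(t in f T) #|f T :&: Qnbrs (fun x y =>
  (x, y) \in Q) t| <= r * n)%N.
Hypothesis Ss0 : (#|S| <= s0)%N.

(** A small container gains [b] for each of the at least [m / 2] edges outside [S]. A large one is
    almost tripartite: a far [H] has at least [delta * m - s0] edges in its small non-rainbow part,
    and the assumption on [kap] makes the exponent at most [- m]. *)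
Lemma count_fingerprint (K : nat) (rho kap : R) :
  (forall c : 'I_n -> 'I_3, #|rainbow_triples c| <= K)%N ->
  0 <= rho -> (m < K)%N -> m%:R <= rho * (K - m)%:R ->
  (2 / 9 - b) * n%:R ^+ 3 <= 6 * (1 - b) * K%:R ->
  2 * s0%:R <= m%:R :> R -> 0 <= kap ->
  m%:R <= kap * (delta * m%:R - s0%:R) - expR kap * (rho * (495 * b * n%:R ^+ 3)) ->
  #|[set H in bad | [&& codegree_ge3 H == Q, S \subset H & H :\: S \subset container f
    Q S]]|%:R
    <= rho ^+ #|S| * 'C(K, m)%:R * expR (- (b * m%:R / 2)).
Proof.
move=> KP rho0 mK rhoP hK hs kap0 hkap; set HH := [set H in bad | _].
have Ss0' : #|S|%:R <= s0%:R :> R by rewrite ler_nat.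
have HHm : {in HH, forall H : hypergraph 'I_n, #|H| = m /\ S \subset H}.
  by move=> H; rewrite !inE => /andP[/andP[/and3P[_ _ /eqP->] _] /and3P[_ ->]].
have HHG : {in HH, forall H : hypergraph 'I_n, H :\: S \subset container f Q S}.
  by move=> H; rewrite !inE => /andP[_ /and3P[]].
have b01 : 0 <= b <= 1.
  by rewrite (ltW b0) (le_trans b9) // ler_pdivrMr ?ltr0n // mul1r ler1n.
have [hG|hG] := lerP ((2 / 9 - b) * n%:R ^+ 3) (6 * #|container f Q S|%:R); last first.
  have hG' : #|container f Q S|%:R <= (1 - b) * K%:R by lra.
  apply: le_trans (count_small_container HHm rho0 mK rhoP b01 hG' HHG) _.
  rewrite ler_wpM2l ?ler_expR ?lerN2 ?mulr_ge0 ?exprn_ge0 ?ler0n //.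
  have : 0 <= b * (m%:R - 2 * #|S|%:R) by rewrite mulr_ge0 ?(ltW b0) // subr_ge0; lra.
  lra.
have := @container_stability 'I_n R b r f Q S b0 b9; rewrite card_ord.
case/(_ n0 rb spf hG) => c hc.
set B := [set e in _ | _] in hc.
pose G0 := [set e in container f Q S | rainbow c e].
have G0K : (#|G0| <= K)%N.
  apply: leq_trans (KP c); apply: subset_leq_card; apply/subsetP => e.
  by rewrite !inE => /andP[/andP[-> _] ->].
have sub : {in HH, forall H : hypergraph 'I_n, H :\: S \subset G0 :|: B}.
  move=> H HHH; apply/subsetP => e /(subsetP (HHG H HHH)) eG.
  by rewrite in_setU [e \in G0]inE [e \in B]inE eG /= orbN.
have Hj : {in HH, forall H : hypergraph 'I_n,
    delta * m%:R - s0%:R <= #|(H :\: S) :&: B|%:R}.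
  move=> H HHH; apply: (@le_trans _ _ (delta * m%:R - #|S|%:R)); first lra.
  apply: far_nonrainbow; last exact: HHG.
    by move: HHH; rewrite inE => /andP[].
  by have [] := HHm H HHH.
apply: le_trans (count_split_container HHm rho0 mK rhoP kap0 G0K sub Hj) _.
rewrite ler_wpM2l ?ler_expR ?mulr_ge0 ?exprn_ge0 ?ler0n //.
have h1 : expR kap * (rho * #|B|%:R) <= expR kap * (rho * (495 * b * n%:R ^+ 3)).
  by rewrite ler_wpM2l ?expR_ge0 // ler_wpM2l.
have h2 : b * m%:R <= 1 * m%:R by rewrite ler_wpM2r ?ler0n //; case/andP: b01.
have : 0 <= m%:R :> R by rewrite ler0n.
lra.
Qed.

(** The container includes [H :\: S], so it is dense; its non-rainbow edges together with [S] are
    then too few for [H] to be far. *)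
Lemma large_not_far (b1 : R) : b <= b1 -> b1 <= 1 / 9 ->
  (2 / 9 - b1) * n%:R ^+ 3 <= 6 * (m%:R - s0%:R) ->
  495 * b1 * n%:R ^+ 3 + s0%:R < delta * m%:R ->
  [set H in bad | [&& codegree_ge3 H == Q, S \subset H & H :\: S \subset container f Q
    S]] = set0.
Proof.
move=> bb1 b19 hm hd; apply/eqP; apply: contraLR isT => /set0Pn[H].
rewrite inE => /andP[Hbad /and3P[_ SH HG]].
have Ss0' : #|S|%:R <= s0%:R :> R by rewrite ler_nat.
have Hm : #|H| = m by move: Hbad; rewrite !inE => /andP[/and3P[_ _ /eqP]].
have := @container_stability 'I_n R b1 r f Q S; rewrite card_ord.
case/(_ (lt_le_trans b0 bb1) b19 n0) => [|||c] //.
- by apply: le_trans rb _; rewrite ler_wpM2r ?ler0n.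
- apply: le_trans hm _; rewrite ler_wpM2l ?ler0n //.
  apply: (@le_trans _ _ #|H :\: S|%:R); last by rewrite ler_nat subset_leq_card.
  rewrite cardsD (setIidPr SH) Hm natrB ?lerB // -Hm subset_leq_card //.
set B := [set e in _ | _] => hc.
have := far_nonrainbow c Hbad SH HG; rewrite -/B.
have : #|(H :\: S) :&: B|%:R <= #|B|%:R :> R by
  rewrite ler_nat subset_leq_card // subsetIr.
lra.
Qed.
End Fingerprint.

(* The graph [Q] is summed over all [2 ^ (n ^ 2)] possibilities instead of being
   encoded in the fingerprint: this costs [exp (O(n ^ 2))], affordable since [m] is
   at least a large multiple of [n ^ 2]. *)
Lemma card_far_le (q : nat) (W : hypergraph 'I_n -> R) : (0 < q <= n)%N ->
  (forall S, 0 <= W S) ->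
  (forall (f : {set 'I_n} -> {set 'I_n}) (Q : {set 'I_n * 'I_n}) (S : hypergraph 'I_n),
    (forall T, \sum_(t in f T) #|f T :&: Qnbrs (fun x y =>
      (x, y) \in Q) t| <= n %/ q * n)%N ->
    (#|S| <= n ^ 2 * (2 * q))%N ->
    #|[set H in bad | [&& codegree_ge3 H == Q, S \subset H & H :\: S \subset container
      f Q S]]|%:R
      <= W S) ->
  #|bad|%:R <= (2 ^ (n ^ 2))%N%:R * \sum_(S : hypergraph 'I_n |
       (S \subset [set e : {set 'I_n} | #|e| == 3]) && (#|S| <= n ^ 2 * (2 * q))%N) W S.
Proof.
case/andP=> q0 qn W0 hW.
pose A (Q : {set 'I_n * 'I_n}) := [set H in bad | codegree_ge3 H == Q].
have : (#|bad| <= \sum_(Q : {set 'I_n * 'I_n}) #|A Q|)%N.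
  by apply: card_le_cover => H Hbad; exists (codegree_ge3 H); rewrite // inE Hbad eqxx.
rewrite -(ler_nat R) natr_sum => h; apply: le_trans h _.
have cQ : #|{set 'I_n * 'I_n}| = (2 ^ (n ^ 2))%N.
  by rewrite -cardsT -powersetT card_powerset cardsT card_prod card_ord mulnn.
set X := \sum_(S | _) W S; have ->
  : (2 ^ (n ^ 2))%N%:R * X = \sum_(Q : {set 'I_n * 'I_n}) X.
  by rewrite sumr_const cQ mulr_natl.
apply: ler_sum => Q _.
have [f [spf hf]] := graph_container (fun x y => (x, y) \in Q) (n %/ q) [set: 'I_n].
rewrite card_ord in spf.
have : (#|A Q| <= \sum_(S : hypergraph 'I_n |
       (S \subset [set e : {set 'I_n} | #|e| == 3]) && (#|S| <= n ^ 2 * (2 * q)))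
    #|[set H in bad | [&& codegree_ge3 H == Q, S \subset H & H :\: S \subset container
      f Q S]]|)%N.
  apply: card_le_cover => H; rewrite !inE => /andP[Hbad /eqP HQ].
  have /andP[/and3P[uH tfH _] _] := Hbad.
  have [||S [SH cS SG]] := @container_cover _ H f (2 * q) _ uH _ tfH.
  - by lia.
  - move=> I indI; have [|T [TI cT hT]] := hf I (subsetT _).
      by move=> x y xI yI; have := indI x y xI yI; rewrite HQ.
    exists T; split=> //; move: cT; rewrite cardsT card_ord => cT.
    (* As [q <= n], rounding down [n / q] loses less than a factor 2; hence the fingerprint size
       [2 * q]. *)
    have nq : (n < 2 * q * (n %/ q))%N.
      have := divn_eq n q; have := ltn_pmod n q0.
      have : (0 < n %/ q)%N by rewrite divn_gt0.
      nia.
    by apply/ltnW; have := leq_ltn_trans cT nq; rewrite ltn_mul2r => /andP[].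
  exists S; last by rewrite !inE Hbad HQ eqxx SH -HQ SG.
  rewrite card_ord in cS; rewrite cS andbT; apply/subsetP => e eS.
  by rewrite inE (forall_inP uH) // (subsetP SH).
rewrite -(ler_nat R) natr_sum => h; apply: le_trans h _.
by apply: ler_sum => S /andP[_ cS]; apply: hW.
Qed.

End Bad.

(** * The two ranges of [m] and the choice of constants *)

(** In the exponent, [n ^ 2] pays for the choice of [Q], the [ell] terms for the sum of
    [rho ^+ #|S|] over fingerprints, and [- b * m / 2] is the gain from [count_fingerprint]. *)
Lemma card_far_sparse (R : realType) (n m q : nat) (delta b rho kap ell : R) :
  0 < b -> b <= 1 / 9 -> (0 < q <= n)%N -> (n %/ q)%N%:R <= b * n%:R ->
  0 <= rho -> (m < max_rainbow n)%N -> m%:R <= rho * (max_rainbow n - m)%:R ->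
  (2 / 9 - b) * n%:R ^+ 3 <= 6 * (1 - b) * (max_rainbow n)%:R ->
  2 * (n ^ 2 * (2 * q))%N%:R <= m%:R :> R -> 0 <= kap -> 0 <= ell ->
  m%:R <= kap * (delta * m%:R - (n ^ 2 * (2 * q))%N%:R)
          - expR kap * (rho * (495 * b * n%:R ^+ 3)) ->
  #|far_from_tripartite n m delta|%:R <=
    expR (n%:R ^+ 2 + ell * (n ^ 2 * (2 * q))%N%:R
          + expR (- ell) * (rho * n%:R ^+ 3) - b * m%:R / 2)
    * #|triangle_free_hypergraphs n m|%:R.
Proof.
move=> b0 b9 qn rb rho0 mK rhoP hK hs kap0 ell0 hkap.
set s0 := (n ^ 2 * (2 * q))%N in hs hkap *.
pose W (S : hypergraph 'I_n) := rho ^+ #|S| * 'C(max_rainbow n, m)%:R * expR (- (b *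
  m%:R / 2)).
have W0 S : 0 <= W S by rewrite mulr_ge0 ?expR_ge0 // mulr_ge0 ?exprn_ge0 ?ler0n.
have n0 : (0 < n)%N by case/andP: qn => q0; apply: leq_trans.
apply: le_trans (card_far_le qn W0 _) _.
  move=> f Q S spf cS.
  exact: (count_fingerprint b0 b9 n0 rb spf cS (@rainbow_le_max n) rho0 mK rhoP hK hs
    kap0 hkap).
rewrite /W -!mulr_suml.
have hX : \sum_(S : hypergraph 'I_n | (S \subset [set e : {set 'I_n} | #|e| == 3]) &&
  (#|S| <= s0)%N)
    rho ^+ #|S| <= expR (ell * s0%:R + expR (- ell) * (rho * n%:R ^+ 3)).
  have hP (S : hypergraph 'I_n) : (#|S| <= s0)%N -> ell * #|S|%:R <= ell * s0%:R.
    by move=> cS; rewrite ler_wpM2l ?ler_nat.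
  apply: le_trans (sum_subset_tilt _ rho0 hP) _.
  rewrite ler_expR lerD2l ler_wpM2l ?expR_ge0 // ler_wpM2l // card_draws card_ord.
  by rewrite -natrX ler_nat bin3_le.
have h2 : (2 ^ (n ^ 2))%N%:R <= expR (n%:R ^+ 2) :> R.
  rewrite natrX -(natrX R n 2) -[X in expR X]mulr1 expRM_natl lerXn2r ?nnegrE ?expR_ge0
    //.
  by have := @expR_ge1Dx R 1.
have hC : 'C(max_rainbow n, m)%:R <= #|triangle_free_hypergraphs n m|%:R :> R.
  by rewrite ler_nat bin_max_rainbow_le.
have -> : expR (n%:R ^+ 2 + ell * s0%:R + expR (- ell) * (rho * n%:R ^+ 3) - b * m%:R /
  2)
  = expR (n%:R ^+ 2) * (expR (ell * s0%:R + expR (- ell) * (rho * n%:R ^+ 3))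
      * expR (- (b * m%:R / 2))) by rewrite -!expRD !addrA.
rewrite -!mulrA; apply: ler_pM h2 _; rewrite ?ler0n //.
  by rewrite mulr_ge0 ?mulr_ge0 ?expR_ge0 ?ler0n // sumr_ge0 // => S _;
    rewrite exprn_ge0.
apply: ler_pM hX _; rewrite ?mulr_ge0 ?expR_ge0 ?ler0n //.
  by rewrite sumr_ge0 // => S _; rewrite exprn_ge0.
by rewrite mulrC ler_wpM2l ?expR_ge0.
Qed.

Lemma card_far_dense (R : realType) (n m q : nat) (delta b b1 : R) :
  0 < b -> b <= b1 -> b1 <= 1 / 9 -> (0 < q <= n)%N -> (n %/ q)%N%:R <= b * n%:R ->
  (2 / 9 - b1) * n%:R ^+ 3 <= 6 * (m%:R - (n ^ 2 * (2 * q))%N%:R) ->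
  495 * b1 * n%:R ^+ 3 + (n ^ 2 * (2 * q))%N%:R < delta * m%:R ->
  #|far_from_tripartite n m delta| = 0.
Proof.
move=> b0 bb1 b19 qn rb hm hd.
have n0 : (0 < n)%N by case/andP: qn => q0; apply: leq_trans.
apply/eqP; rewrite -leqn0 -(ler_nat R).
apply: le_trans (card_far_le qn (fun=> lexx 0) _) _; last by rewrite big1 // mulr0.
move=> f Q S spf cS.
by rewrite (large_not_far b0 n0 rb spf cS bb1 b19 hm hd) cards0.
Qed.

(* The two regimes overlap at [m = (1 - b1) K], [K] being the largest size of a
   tripartite hypergraph: above it no hypergraph is far from tripartite, below
   it [m / (K - m)] is of order [m / n ^ 3].  The factor [300 * 100] exceeds both
   [54 * 496] and [54 * 495], where [54] comes from [n ^ 3 <= 54 * K]. *)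
Lemma card_far_le_eta (R : realType) (n m q : nat) (delta b b1 kap ell eta : R) :
  let s : R := (n ^ 2 * (2 * q))%N%:R in
  0 < b -> b <= b1 -> b1 <= 1 / 9 -> 300 * 100 * b1 <= delta -> 0 < eta ->
  0 <= kap -> kap * delta = 6 -> expR kap * b = b1 / (300 * 100) ->
  0 <= ell -> expR (- ell) * (54 / b1) <= b / 8 ->
  (0 < q <= n)%N -> (n %/ q)%N%:R <= b * n%:R ->
  6 <= b * n%:R -> 27 * s <= b * n%:R ^+ 3 -> 8 <= b * eta * n%:R ->
  n%:R <= m%:R :> R -> 2 * s <= m%:R -> 2 * s <= delta * m%:R ->
  8 * (ell * s) <= b * m%:R -> 8 * n%:R ^+ 2 <= b * m%:R ->
  #|far_from_tripartite n m delta|%:R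
    <= eta * #|triangle_free_hypergraphs n m|%:R.
Proof.
move=> s b0 bb1 b19 b1d eta0 kap0 kapd eb ell0 ellA qn rb bn6 sn bneta nm sm sdm lsm
  n2m.
have b1_gt0 : 0 < b1 by apply: lt_le_trans bb1.
have n1 : 0 < n%:R :> R by rewrite ltr0n; case/andP: qn; apply: leq_trans.
have n3 : 0 < n%:R ^+ 3 :> R by rewrite exprn_gt0.
have m0 : 0 < m%:R :> R by apply: lt_le_trans nm.
have hK : (1 - b) * n%:R ^+ 3 <= 27 * (max_rainbow n)%:R := max_rainbow_asymp b0 bn6.
have bn3 : b * n%:R ^+ 3 <= b1 * n%:R ^+ 3 by rewrite ler_wpM2r // ltW.
have b1n3 : b1 * n%:R ^+ 3 <= 1 / 9 * n%:R ^+ 3 by rewrite ler_wpM2r // ltW.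
have K_ge : n%:R ^+ 3 <= 54 * (max_rainbow n)%:R :> R by lra.
have b1n3_gt0 : 0 < b1 * n%:R ^+ 3 by rewrite mulr_gt0.
have b1bn3 : 0 <= b1 * b * n%:R ^+ 3 by rewrite !mulr_ge0 // ltW.
have b0n3 : 0 <= b * n%:R ^+ 3 by rewrite mulr_ge0 // ltW.
have bbn3 : 0 <= b * b * n%:R ^+ 3 by rewrite !mulr_ge0 // ltW.
have hK1 : (1 - b1) * ((1 - b) * n%:R ^+ 3) <= (1 - b1) * (27 * (max_rainbow n)%:R).
  by rewrite ler_wpM2l //; lra.
have [hm|hm] := lerP m%:R ((1 - b1) * (max_rainbow n)%:R); last first.
  rewrite (@card_far_dense R n m q delta b b1) //.
  - by rewrite mulr_ge0 ?ler0n ?(ltW eta0).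
  - rewrite -/s; lra.
  - rewrite -/s.
    have hmn : n%:R ^+ 3 / 54 <= m%:R :> R by lra.
    have := ler_wpM2l (ltW b1_gt0) hmn; have := ler_wpM2r (ltW m0) b1d; lra.
have b1K : 0 < b1 * (max_rainbow n)%:R by rewrite mulr_gt0 //; lra.
(* Here [K - m >= b1 * K >= b1 * n ^ 3 / 54], so this [rho] bounds [m / (K - m)]. *)
pose rho := 54 * m%:R / (b1 * n%:R ^+ 3).
have rho0 : 0 <= rho.
  by apply: divr_ge0 (ltW b1n3_gt0); rewrite mulr_ge0 ?ler0n.
have rhob : rho * (b1 * n%:R ^+ 3) = 54 * m%:R by rewrite /rho divfK // gt_eqF.
have rhoA : rho * n%:R ^+ 3 = 54 / b1 * m%:R.
  by rewrite -[RHS]mulrAC -rhob; field; rewrite gt_eqF.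
clearbody rho.
apply: le_trans (card_far_sparse (kap := kap) (ell := ell) b0 _ qn rb rho0 _ _ _ sm
  kap0 ell0 _) _.
- exact: le_trans b19.
- by rewrite -(ltr_nat R); apply: le_lt_trans hm _; lra.
- rewrite natrB; last by rewrite -(ler_nat R); apply: le_trans hm _; lra.
  have h : b1 * n%:R ^+ 3 <= 54 * ((max_rainbow n)%:R - m%:R).
    have := ler_wpM2l (ltW b1_gt0) K_ge; lra.
  have := ler_wpM2l rho0 h; rewrite rhob; lra.
- have : (1 - b) * ((1 - b) * n%:R ^+ 3) <= (1 - b) * (27 * (max_rainbow n)%:R).
    by rewrite ler_wpM2l //; lra.
  lra.
(* Of [kap * delta * m = 6 * m], at most [3 * m] is lost to the fingerprint and less than [m] to the
   tilting. *)
- have -> : expR kap * (rho * (495 * b * n%:R ^+ 3))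
    = 495 * (expR kap * b) * (rho * n%:R ^+ 3) by ring.
  rewrite eb rhoA.
  have -> : 495 * (b1 / (300 * 100)) * (54 / b1 * m%:R)
    = 495 * 54 / (300 * 100) * m%:R by field; rewrite gt_eqF.
  have hkd : kap * (delta * m%:R) = 6 * m%:R by rewrite mulrA kapd.
  have := ler_wpM2l kap0 sdm; rewrite mulrBr hkd -/s; lra.
rewrite ler_wpM2r ?ler0n // -/s rhoA mulrA.
have h := ler_wpM2r (ltW m0) ellA.
(* Each of the three positive terms of the exponent is at most [z] and the negative one is
   [- 4 * z]; then [expR (- z) <= 1 / (1 + z) <= eta]. *)
set z := b * m%:R / 8; have hz : 1 <= eta * z.
  have : b * eta * n%:R <= b * eta * m%:R by rewrite ler_wpM2l // mulr_ge0 // ltW.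
  rewrite /z; lra.
apply: (@le_trans _ _ (expR (- z))); first by rewrite ler_expR /z; lra.
rewrite expRN -[X in X <= _]mul1r ler_pdivrMr ?expR_gt0 //.
apply: le_trans hz _; rewrite ler_wpM2l ?(ltW eta0) //.
by apply: le_trans (expR_ge1Dx z); rewrite lerDr.
Qed.

(** The constants [b1], [kap], [b], [q], [ell] are chosen in this order from [delta] alone, and so
    is [C]; [eta] enters only through [n0]. *)
Theorem theorem8p2 (R : realType) (delta : R) (delta_gt0 : 0 < delta) :
  exists C : R, forall eta : R, 0 < eta ->
    exists n0 : nat, forall n m : nat, (n0 <= n)%N ->
      C * n%:R ^+ 2 <= m%:R -> (m <= 'C(n, 3))%N ->
      #|[set H in triangle_free_hypergraphs n m
          | ~~ tripartite_after_removing (delta * m%:R) H]|%:R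
      <= eta * #|triangle_free_hypergraphs n m|%:R.
Proof.
pose b1 : R := Num.min (1 / 9) (delta / (300 * 100)).
have b1_gt0 : 0 < b1 by rewrite /b1 lt_min; apply/andP; split; lra.
have b19 : b1 <= 1 / 9 by rewrite ge_min lexx.
have b1d : 300 * 100 * b1 <= delta.
  by rewrite mulrC -ler_pdivlMr; [rewrite ge_min lexx orbT|lra].
clearbody b1.
pose kap := 6 / delta.
have kap0 : 0 <= kap by rewrite divr_ge0 // ltW.
have kapd : kap * delta = 6 by rewrite /kap divfK // gt_eqF.
have e1 : 1 <= expR kap by have := expR_ge1Dx kap; lra.
(* Small enough to absorb the factor [expR kap] that tilting costs on the non-rainbow part. *)
pose b := b1 / (300 * 100 * expR kap).
have eb : expR kap * b = b1 / (300 * 100).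
  by rewrite /b; field; rewrite gt_eqF //; lra.
have b0 : 0 < b by rewrite divr_gt0 // mulr_gt0; lra.
have bb1 : b <= b1 by have := ler_peMl (ltW b0) e1; rewrite eb; lra.
clearbody b kap.
pose q := Num.bound b^-1.
have qb : 1 <= q%:R * b.
  rewrite -ler_pdivrMr // div1r; apply/ltW/archi_boundP.
  by rewrite invr_ge0 ltW.
have q0 : (0 < q)%N.
  by rewrite lt0n; apply: contraL qb => /eqP->; rewrite mul0r -ltNge ltr01.
clearbody q.
pose ell := 8 * (54 / b1) / b.
have ell0 : 0 <= ell by rewrite !mulr_ge0 ?invr_ge0 ?(ltW b0) ?(ltW b1_gt0) ?ler0n.
have ellA : expR (- ell) * (54 / b1) <= b / 8.
  rewrite expRN mulrC ler_pdivrMr ?expR_gt0 //.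
  have -> : 54 / b1 = b / 8 * ell by rewrite /ell; field; rewrite !gt_eqF.
  rewrite ler_wpM2l ?divr_ge0 ?(ltW b0) //.
  by apply: le_trans (expR_ge1Dx ell); rewrite lerDr.
clearbody ell.
pose q2 : R := 2 * q%:R.
have q2_ge0 : 0 <= q2 by rewrite mulr_ge0 ?ler0n.
have bV : 0 <= b^-1 by rewrite invr_ge0 ltW.
have dV : 0 <= delta^-1 by rewrite invr_ge0 ltW.
(* With [s = q2 * n ^ 2], the summands yield in order [8 * ell * s <= b * m], [8 * n ^ 2 <= b * m],
   [2 * s <= m], [2 * s <= delta * m] and [n <= m]. *)
pose C := 8 * (ell * q2) * b^-1 + 8 * b^-1 + 2 * q2 + 2 * q2 * delta^-1 + 1.
exists C => eta eta0.
have beV : 0 <= (b * eta)^-1 by rewrite invr_ge0 mulr_ge0 // ltW.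
(* The summands yield in order [q <= n], [6 <= b * n], [27 * s <= b * n ^ 3], [8 <= b * eta * n] and
   [1 <= n]. *)
pose N : R := q%:R + 6 * b^-1 + 27 * q2 * b^-1 + 8 * (b * eta)^-1 + 1.
exists (Num.bound N) => n m hn hC _.
have pos := (q2_ge0, bV, dV, beV, ell0).
have t1 : 0 <= 6 * b^-1 by rewrite mulr_ge0 ?pos.
have t2 : 0 <= 27 * q2 * b^-1 by rewrite !mulr_ge0 ?pos.
have t3 : 0 <= 8 * (b * eta)^-1 by rewrite mulr_ge0 ?pos.
have t4 : 0 <= q%:R :> R by rewrite ler0n.
have N_ge : N <= n%:R.
  apply: (@le_trans _ _ (Num.bound N)%:R); last by rewrite ler_nat.
  by apply/ltW/archi_boundP; rewrite /N; lra.
have c1 : 0 <= 8 * (ell * q2) * b^-1 by rewrite !mulr_ge0 ?pos.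
have c2 : 0 <= 8 * b^-1 by rewrite mulr_ge0 ?pos.
have c4 : 0 <= 2 * q2 * delta^-1 by rewrite !mulr_ge0 ?pos.
have scale (c k u v : R) : 0 < c -> k * c^-1 * u <= v -> k * u <= c * v.
  move=> c0; rewrite -(ler_pM2l c0).
  by have -> : c * (k * c^-1 * u) = k * u by field; rewrite gt_eqF.
have N_scale (c k : R) : 0 < c -> k * c^-1 <= N -> k <= c * n%:R.
  by move=> c0 kN; rewrite -[k]mulr1; apply: scale; rewrite // mulr1 (le_trans kN).
have C_scale k : k <= C -> k * n%:R ^+ 2 <= m%:R.
  by move=> kC; apply: le_trans hC; rewrite ler_wpM2r // exprn_ge0.
have s_E : (n ^ 2 * (2 * q))%N%:R = q2 * n%:R ^+ 2 :> R.
  by rewrite natrM natrX natrM mulrC.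
have n1 : 1 <= n%:R :> R by apply: le_trans N_ge; rewrite /N; lra.
apply: (card_far_le_eta (q := q) b0 bb1 b19 b1d eta0 kap0 kapd eb ell0 ellA _ _ _ _ _ _
  _ _ _ _);
  rewrite ?s_E.
- by rewrite q0 -(ler_nat R); apply: le_trans N_ge; rewrite /N; lra.
- have h : (n %/ q)%N%:R * q%:R <= n%:R :> R by rewrite -natrM ler_nat leq_trunc_div.
  apply: le_trans (ler_wpM2l (ltW b0) h).
  by rewrite mulrC -mulrA ler_peMr ?ler0n.
- by apply: N_scale; rewrite // /N; lra.
- have -> : b * n%:R ^+ 3 = b * n%:R * n%:R ^+ 2 by ring.
  rewrite mulrA ler_wpM2r ?exprn_ge0 //.
  by apply: N_scale; rewrite // /N; lra.
- by apply: N_scale; rewrite ?mulr_gt0 // /N; lra.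
- apply: le_trans (C_scale 1 _); last by rewrite /C; lra.
  by rewrite mul1r expr2 ler_peMr.
- by rewrite mulrA; apply: C_scale; rewrite /C; lra.
- by rewrite mulrA; apply: scale => //; apply: C_scale; rewrite /C; lra.
- by rewrite mulrA mulrA -[8 * ell * q2]mulrA; apply: scale => //; apply: C_scale;
    rewrite /C; lra.
- by apply: scale => //; apply: C_scale; rewrite /C; lra.
Qed.
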